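(* Let $a,q\in(0,1)$ and consider the ABC pseudo-marginal Markov kernel $\tilde P$ with prior and ABC likelihood $$\nu(x)=(1-q)q^{x-1}\mathbf{1}_{\{1,2,\ldots\}}(x),\qquad\ell_{\mathrm{ABC}}(x)=a^{x-1}\mathbf{1}_{\{1,2,\ldots\}}(x),$$ proposal $q(x,x-1)=q(x,x+1)=1/2$, and $N$ pseudo-observations. Then, for any $N\ge1$, if $\tilde P$ admits a $(\Phi,\beta)$-WPI with $\Phi=\|\cdot\|_{\mathrm{osc}}^2$, then $$\beta(s)\in\Omega\left(s^{-\frac{\log(aq)}{\log(a)}}\right)\quad\text{as }s\to\infty .$$
   Context: $q\in(0,1)$ (a number) is distinguished from the proposal kernel $q(\cdot,\cdot)$ on the integers. The ABC posterior is $\pi(x)\propto\nu(x)\ell_{\mathrm{ABC}}(x)$ on $\{1,2,\ldots\}$ ($\pi=0$ elsewhere). For $x\in\{1,2,\dots\}$, $Q_x$ is the law of $\frac1N\sum_{i=1}^NW_i$ with $W_i=B_i/\ell_{\mathrm{ABC}}(x)$ and $B_1,\ldots,B_N$ independent $\mathrm{Bernoulli}(\ell_{\mathrm{ABC}}(x))$; thus $\int w\,Q_x(\mathrm{d}w)=1$. The pseudo-marginal target on pairs $(x,w)\in\{1,2,\ldots\}\times(0,\infty)$ is $\tilde\pi(x,\mathrm{d}w)=\pi(x)\,w\,Q_x(\mathrm{d}w)$. The kernel $\tilde P$ is the $\tilde\pi$-reversible Markov kernel which, for measurable $A$ with $(x,w)\notin A$, satisfies $$\tilde P(x,w;A)=\sum_yq(x,y)\int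 Q_y(\mathrm{d}u)\left\{1\wedge r(x,y)\frac uw\right\}\mathbf{1}_A(y,u),\qquad r(x,y)=\frac{\pi(y)q(y,x)}{\pi(x)q(x,y)},$$ the remaining mass being at $(x,w)$ (proposals to $y=0$ are rejected, since $\pi(0)=0$). $\|f\|_{\mathrm{osc}}=\mathrm{ess}\sup f-\mathrm{ess}\inf f$ with respect to $\tilde\pi$. $(\|\cdot\|_{\mathrm{osc}}^2,\beta)$-WPI: $\beta:(0,\infty)\to[0,\infty)$ is decreasing with $\beta(s)\to0$ as $s\to\infty$ and $\|f\|_2^2\le s\langle(\mathrm{Id}-\tilde P)f,f\rangle+\beta(s)\|f\|_{\mathrm{osc}}^2$ for all $s>0$ and all real $f\in L^2(\tilde\pi)$ with $\tilde\pi(f)=0$. $f(s)\in\Omega(g(s))$ as $s\to\infty$ means $\liminf_{s\to\infty}|f(s)/g(s)|>0$. *)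

(* Defs.v *)
From HB Require Import structures.
From mathcomp Require Import all_boot all_order all_algebra.
From mathcomp Require Import all_classical all_reals all_analysis.
From mathcomp Require Import measurable_realfun ess_sup_inf.

Set Implicit Arguments.
Unset Strict Implicit.
Unset Printing Implicit Defensive.
Import Order.TTheory GRing.Theory Num.Theory.
Import numFieldNormedType.Exports.

Local Open Scope classical_set_scope.
Local Open Scope ring_scope.

Section weak_poincare.
Context d (T : measurableType d) (R : realType).
Variable mu : {measure set T -> \bar R}.
Implicit Types (f g : T -> R) (P : R.-pker T ~> T).

Definition inner_prod f g : \bar R := (\int[mu]_z (f z * g z)%:E)%E.

Definition markov_op P f (z : T) : R := \int[P z]_y f y.

Definition osc_norm f : \bar R :=
  (ess_sup mu (EFin \o f) - ess_inf mu (EFin \o f))%E.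

(* [beta] is only constrained on (0, +oo). In the last clause Phi may take the
   value +oo, with the usual measure-theoretic convention 0 * +oo = 0. *)
Definition is_WPI P (Phi : (T -> R) -> \bar R) (beta : R -> R) : Prop :=
  [/\ forall s, 0 < s -> 0 <= beta s,
      forall s t, 0 < s -> s <= t -> beta t <= beta s,
      beta s @[s --> +oo] --> (0 : R) &
      forall (s : R) f, 0 < s -> f \in Lfun mu 2%:E ->
        (\int[mu]_z (f z)%:E = 0)%E ->
        (inner_prod f f <=
         s%:E * inner_prod (f \- markov_op P f)%R f + (beta s)%:E * Phi f)%E].

End weak_poincare.

Definition is_Omega (R : realType) (f g : R -> R) : Prop :=
  (0 < limf_einf (fun s => `|f s / g s|%:E) (pinfty_nbhs R))%E.

(* Positions are natural numbers: the state space is {1, 2, ...} x (0, +oo),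
   inside nat * R. From x >= 1 the walk on the integers only reaches x +- 1 >= 0,
   and 0 carries no target mass, so negative positions play no role. *)
Section abc_model.
Context {R : realType}.
Implicit Types (a q : {itv R & `]0, 1[}) (N x y : nat).

Definition abc_prior q x : R := (0 < x)%:R * ((1 - q%:num) * q%:num ^+ x.-1).

Definition abc_lik a x : R := (0 < x)%:R * a%:num ^+ x.-1.

Definition abc_post a q x : R :=
  abc_prior q x * abc_lik a x /
  limn (series (fun k => abc_prior q k * abc_lik a k)).

Definition walk x y : R := if (y == x.+1) || (x == y.+1) then 2^-1 else 0.

Definition abc_ratio a q x y : R :=
  (abc_post a q y * walk y x) / (abc_post a q x * walk x y).

Definition abc_weight a N x (b : {ffun 'I_N -> bool}) : R :=
  N%:R^-1 * \sum_(i < N) (b i)%:R / abc_lik a x.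

(* Law of [abc_weight] when the N coordinates are independent Bernoulli variables
   with parameter [abc_lik a x]. *)
Definition abc_weight_law a N x (A : set R) : \bar R :=
  (\sum_(b : {ffun 'I_N -> bool})
     (\prod_(i < N) bernoulli_pmf (abc_lik a x) (b i))%:E *
     \d_(abc_weight a x b) A)%E.

Definition pm_target a q N (A : set (nat * R)) : \bar R :=
  (\sum_(1 <= x <oo) (abc_post a q x)%:E *
     \int[abc_weight_law a N x]_(w in `]0%R, +oo[) (w * \1_A (x, w))%:E)%E.

Definition pm_accept a q (z z' : nat * R) : R :=
  Num.min 1 (abc_ratio a q z.1 z'.1 * (z'.2 / z.2)).

Definition pm_move a q N (z : nat * R) (A : set (nat * R)) : \bar R :=
  (\sum_(1 <= y <oo) (walk z.1 y)%:E *
     \int[abc_weight_law a N y]_(u in `]0%R, +oo[)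
       (pm_accept a q z (y, u) * \1_A (y, u))%:E)%E.

(* The mass not moved stays at z; points outside {1, 2, ...} x (0, +oo), which are
   negligible for [pm_target] and never reached from inside, are absorbing. *)
Definition pm_trans a q N (z : nat * R) (A : set (nat * R)) : \bar R :=
  if (0 < z.1)%N && (0 < z.2) then
    (pm_move a q N z A + (1 - pm_move a q N z setT) * \d_z A)%E
  else \d_z A.

Section proofs.
Variables (a q : {itv R & `]0, 1[}) (N : nat).

Lemma abc_lik_itv x : 0 <= abc_lik a x <= 1.
Proof.
rewrite /abc_lik; case: x => [|x]; first by rewrite mul0r lexx ler01.
by rewrite mul1r exprn_ge0//= exprn_ile1.
Qed.

Lemma abc_prior_ge0 x : 0 <= abc_prior q x.
Proof. by rewrite /abc_prior !mulr_ge0// subr_ge0. Qed.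

Lemma abc_post_ge0 x : 0 <= abc_post a q x.
Proof.
have h k : 0 <= abc_prior q k * abc_lik a k.
  by rewrite mulr_ge0 ?abc_prior_ge0//; have /andP[] := abc_lik_itv k.
rewrite /abc_post divr_ge0//.
set u := series _.
have [cu|dv] := pselect (cvgn u); last by rewrite dvgP.
by apply: limr_ge => //; apply: nearW => n; apply: sumr_ge0.
Qed.

Lemma walk_ge0 x y : 0 <= walk x y :> R.
Proof. by rewrite /walk; case: ifP. Qed.

Lemma abc_ratio_ge0 x y : 0 <= abc_ratio a q x y.
Proof.
by apply: divr_ge0; apply: mulr_ge0; rewrite ?abc_post_ge0 ?walk_ge0.
Qed.

Local Open Scope ereal_scope.

Section abc_weight_law_measure.
Variable x : nat.

Let pmf_ge0 (b : {ffun 'I_N -> bool}) :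
  (0 <= \prod_(i < N) bernoulli_pmf (abc_lik a x) (b i))%R.
Proof. by apply: prodr_ge0 => i _; exact/bernoulli_pmf_ge0/abc_lik_itv. Qed.

Let law0 : abc_weight_law a N x set0 = 0.
Proof. by rewrite /abc_weight_law big1// => b _; rewrite measure0 mule0. Qed.

Let law_ge0 A : 0 <= abc_weight_law a N x A.
Proof. by apply: sume_ge0 => b _; rewrite mule_ge0// lee_fin. Qed.

Let law_sigma_additive : semi_sigma_additive (abc_weight_law a N x).
Proof.
move=> F mF tF mUF; apply: cvg_toP.
  by apply: is_cvg_nneseries => n _ _; exact: law_ge0.
rewrite /abc_weight_law nneseries_sum; last first.
  by move=> b j _; rewrite mule_ge0// lee_fin.
apply: eq_bigr => b _.
by rewrite nneseriesZl//; congr (_ * _); rewrite [RHS]measure_semi_bigcup.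
Qed.

HB.instance Definition _ := isMeasure.Build _ _ _ (abc_weight_law a N x)
  law0 law_ge0 law_sigma_additive.

Let law_setT : abc_weight_law a N x setT = 1.
Proof.
rewrite /abc_weight_law; under eq_bigr do rewrite diracT mule1.
rewrite sumEFin -(bigA_distr_bigA
  (fun (_ : 'I_N) (b : bool) => bernoulli_pmf (abc_lik a x) b))/= big1// => i _.
by rewrite big_bool/= addrCA subrr addr0.
Qed.

HB.instance Definition _ :=
  @Measure_isProbability.Build _ _ R (abc_weight_law a N x) law_setT.

End abc_weight_law_measure.

Section layered_measure.
Variables (c : nat -> R) (g : nat -> R -> R) (mu : nat -> {measure set R -> \bar R}).
Hypothesis c_ge0 : forall x, (0 <= c x)%R.
Hypothesis g_ge0 : forall x w, (0 < w)%R -> (0 <= g x w)%R.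
Hypothesis mg : forall x, measurable_fun setT (g x).

Definition layered (A : set (nat * R)) : \bar R :=
  \sum_(1 <= x <oo) (c x)%:E *
    \int[mu x]_(w in `]0%R, +oo[) (g x w * \1_A (x, w))%:E.

Lemma measurable_layer x A : measurable A ->
  measurable_fun [set: R] (EFin \o (fun w : R => g x w * \1_A (x, w))%R).
Proof.
move=> mA; apply/measurable_EFinP; apply: measurable_funM => //.
rewrite (_ : (fun w => \1_A (x, w)) = \1_A \o pair x)//.
by apply: measurableT_comp => //; exact: measurable_pair1.
Qed.

Lemma layer_ge0 x A w : w \in `]0%R, +oo[%classic ->
  0 <= (g x w * \1_A (x, w))%:E.
Proof.
by rewrite inE/= in_itv/= andbT => w0; rewrite lee_fin mulr_ge0// g_ge0.
Qed.

Lemma layered_int_ge0 x A :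
  0 <= \int[mu x]_(w in `]0%R, +oo[) (g x w * \1_A (x, w))%:E.
Proof. by apply: integral_ge0 => w w0; apply: layer_ge0; rewrite inE. Qed.

Lemma layered_ge0 A : 0 <= layered A.
Proof.
apply: nneseries_ge0 => x _ _.
by rewrite mule_ge0 ?lee_fin ?layered_int_ge0.
Qed.

Lemma layered0 : layered set0 = 0.
Proof.
rewrite /layered eseries0// => x _ _.
by rewrite integral0_eq ?mule0// => w _; rewrite indic0 mulr0.
Qed.

Lemma layered_sigma_additive : semi_sigma_additive layered.
Proof.
move=> F mF tF mUF; apply: cvg_toP.
  by apply: is_cvg_nneseries => n _ _; exact: layered_ge0.
transitivity (\sum_(n <oo) \sum_(x <oo | (1 <= x)%N) (c x)%:E *
    \int[mu x]_(w in `]0%R, +oo[) (g x w * \1_(F n) (x, w))%:E).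
  by apply: eq_eseriesr => n _; rewrite /layered eseries_cond.
rewrite nneseries_interchange; last first.
  by move=> n x; rewrite mule_ge0 ?lee_fin ?layered_int_ge0.
rewrite /layered [RHS]eseries_cond; apply: eq_eseriesr => x _.
rewrite nneseriesZl; last by move=> n _; exact: layered_int_ge0.
congr (_ * _); rewrite -integral_nneseries//; first last.
- by move=> n w w0; apply: layer_ge0; rewrite inE.
- by move=> n; apply: measurable_funTS; exact: measurable_layer.
apply: eq_integral => w; rewrite inE/= in_itv/= andbT => w0.
under eq_eseriesr do rewrite EFinM.
by rewrite nneseriesZl ?EFinM ?indic_bigcup// => n _; rewrite lee_fin.
Qed.

End layered_measure.
Let pm_target0 : pm_target a q N set0 = 0.
Proof. exact: layered0. Qed.

Let pm_target_ge0 A : 0 <= pm_target a q N A.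
Proof. by apply: layered_ge0 => [x|x w /ltW//]; exact: abc_post_ge0. Qed.

Let pm_target_sigma_additive : semi_sigma_additive (pm_target a q N).
Proof.
apply: (@layered_sigma_additive _ (fun _ w => w)) => [x|x w /ltW//|//].
exact: abc_post_ge0.
Qed.

HB.instance Definition _ := isMeasure.Build _ _ _ (pm_target a q N)
  pm_target0 pm_target_ge0 pm_target_sigma_additive.

Lemma pm_accept_ge0 z y u : (0 < z.2)%R -> (0 < u)%R ->
  (0 <= pm_accept a q z (y, u))%R.
Proof.
move=> z0 u0; rewrite le_min ler01/= mulr_ge0 ?abc_ratio_ge0//.
by rewrite divr_ge0 ?ltW.
Qed.

Lemma measurable_pm_accept z y :
  measurable_fun setT (fun u : R => pm_accept a q z (y, u)).
Proof.
apply: measurable_minr => //.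
apply: measurable_funM => /=; first exact: measurable_cst.
by apply: measurable_funM => /=; [exact: measurable_id|exact: measurable_cst].
Qed.

Lemma pm_move0 z : pm_move a q N z set0 = 0.
Proof. exact: layered0. Qed.

Lemma pm_move_ge0 z A : (0 < z.2)%R -> 0 <= pm_move a q N z A.
Proof.
move=> z0; apply: layered_ge0 => [y|y u u0]; first exact: walk_ge0.
exact: pm_accept_ge0.
Qed.

Lemma pm_move_sigma_additive z : (0 < z.2)%R ->
  semi_sigma_additive (pm_move a q N z).
Proof.
move=> z0.
apply: (@layered_sigma_additive _ (fun y u => pm_accept a q z (y, u))).
- by move=> y; exact: walk_ge0.
- by move=> y u u0; exact: pm_accept_ge0.
- by move=> y; exact: measurable_pm_accept.
Qed.

Lemma sum_walk x n : (\sum_(1 <= y < n) walk x y <= 1 :> R)%R.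
Proof.
have sum_eq k : (\sum_(1 <= y < n) (y == k)%:R <= 1 :> R)%R.
  rewrite -natr_sum (ler_nat R _ 1).
  rewrite (eq_bigr (fun y => if y == k then 1 else 0)%N) => [|y _]; last first.
    by case: (y == k).
  rewrite -big_mkcond sum1_count count_uniq_mem ?iota_uniq//.
  exact: leq_b1.
apply: (@le_trans _ _ (\sum_(1 <= y < n)
    (2^-1 * (y == x.+1)%:R + 2^-1 * (y == x.-1)%:R))%R).
  apply: ler_sum => y _; rewrite /walk.
  have [->|yx] := eqVneq y x.+1.
    by rewrite /= mulr1 lerDl mulr_ge0.
  have [->|xy] := eqVneq x y.+1; first by rewrite /= eqxx mulr0 mulr1 add0r.
  by rewrite /= mulr0 add0r mulr_ge0.
rewrite big_split/= -!mulr_sumr [leRHS](splitr 1) mul1r.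
by apply: lerD; rewrite ler_piMr.
Qed.

Lemma pm_move_le1 z A : measurable A -> (0 < z.2)%R -> pm_move a q N z A <= 1.
Proof.
move=> mA z0; apply: (@le_trans _ _ (\sum_(1 <= y <oo) (walk z.1 y)%:E)).
  apply: lee_nneseries => [y _ _|y _].
    rewrite mule_ge0 ?lee_fin ?walk_ge0//.
    apply: (@layered_int_ge0 (fun y u => pm_accept a q z (y, u))) => {}y u.
    exact: pm_accept_ge0.
  rewrite -[leRHS]mule1; apply: lee_pmul => //.
  - by rewrite lee_fin walk_ge0.
  - apply: (@layered_int_ge0 (fun y u => pm_accept a q z (y, u))) => {}y u.
    exact: pm_accept_ge0.
  apply: (@le_trans _ _ (\int[abc_weight_law a N y]_(u in `]0%R, +oo[) 1)).
    apply: ge0_le_integral => //.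
    - move=> u /=; rewrite in_itv/= andbT => u0.
      by rewrite lee_fin mulr_ge0// pm_accept_ge0.
    - apply: measurable_funTS.
      apply: (@measurable_layer (fun y u => pm_accept a q z (y, u))) => //.
      by move=> {}y; exact: measurable_pm_accept.
    - move=> u /=; rewrite in_itv/= andbT => u0.
      rewrite lee_fin mulr_ile1 ?pm_accept_ge0//.
      by rewrite /pm_accept ge_min lexx.
  by rewrite integral_cst// mul1e probability_le1.
apply: lime_le; first by apply: is_cvg_nneseries => y _ _; rewrite lee_fin walk_ge0.
by apply: nearW => n; rewrite sumEFin lee_fin sum_walk.
Qed.

Lemma pm_move_fin_num z A : measurable A -> (0 < z.2)%R ->
  pm_move a q N z A \is a fin_num.
Proof.
move=> mA z0; rewrite ge0_fin_numE ?pm_move_ge0//.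
by rewrite (le_lt_trans (pm_move_le1 mA z0)) ?ltry.
Qed.

Let trans0 z : pm_trans a q N z set0 = 0.
Proof.
by rewrite /pm_trans; case: ifPn => _; rewrite measure0// pm_move0 mule0 adde0.
Qed.

Let trans_ge0 z A : 0 <= pm_trans a q N z A.
Proof.
rewrite /pm_trans; case: ifPn => // /andP[_ z0].
rewrite adde_ge0 ?pm_move_ge0// mule_ge0//.
by rewrite sube_ge0 ?pm_move_fin_num// pm_move_le1.
Qed.

Let trans_sigma_additive z : semi_sigma_additive (pm_trans a q N z).
Proof.
have [zE|zE] := boolP ((0 < z.1)%N && (0 < z.2)%R); last first.
  rewrite (_ : pm_trans a q N z = \d_z); first exact: measure_semi_sigma_additive.
  by apply/funext => A; rewrite /pm_trans (negbTE zE).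
have /andP[_ z0] := zE.
pose mv := isMeasure.Build _ _ _ (pm_move a q N z) (pm_move0 z)
  (fun A => pm_move_ge0 A z0) (pm_move_sigma_additive z0).
pose m : {measure set (nat * R) -> \bar R} := HB.pack (pm_move a q N z) mv.
have c0 : (0 <= 1 - fine (pm_move a q N z setT))%R.
  rewrite subr_ge0 -lee_fin fineK; first exact: pm_move_le1.
  exact: pm_move_fin_num.
rewrite (_ : pm_trans a q N z = measure_add m (mscale (NngNum c0) \d_z)).
  exact: measure_semi_sigma_additive.
apply/funext => A; rewrite /pm_trans zE measure_addE/= /mscale/= EFinB fineK//.
exact: pm_move_fin_num.
Qed.

HB.instance Definition _ z := isMeasure.Build _ _ _ (pm_trans a q N z)
  (trans0 z) (trans_ge0 z) (@trans_sigma_additive z).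

Definition pm_kernel (z : nat * R) : {measure set (nat * R) -> \bar R} :=
  pm_trans a q N z.

Let measurable_pm_kernel A : measurable A ->
  measurable_fun setT (fun z => pm_kernel z A).
Proof.
move=> mA.
have mstate : measurable_fun setT (fun z : nat * R => (0 < z.1)%N && (0 < z.2)%R).
  apply: measurable_and.
    exact: (measurableT_comp (f := fun n : nat => (0 < n)%N)).
  exact: measurable_fun_ltr.
have mdirac : measurable_fun setT (fun z : nat * R => \d_z A : \bar R).
  apply/measurable_EFinP.
  have : measurable_fun setT (mindic R mA) by [].
  exact.
pose acc (y : nat) (zu : (nat * R) * R) : R :=
  (Num.max 0 (Num.min 1 (abc_ratio a q zu.1.1 y * (zu.2 * zu.1.2 `^ (-1)))))%R.
pose f B (y : nat) (zu : (nat * R) * R) : \bar R :=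
  (acc y zu * \1_B (y, zu.2) * \1_(`]0%R, +oo[%classic : set R) zu.2)%:E.
have mmove B : measurable B -> measurable_fun setT (fun z : nat * R =>
    \sum_(y <oo | (1 <= y)%N) (walk z.1 y)%:E *
      fubini_F (abc_weight_law a N y) (f B y) z).
  move=> mB; apply: ge0_emeasurable_sum.
  - move=> y z _ _; rewrite mule_ge0 ?lee_fin ?walk_ge0//.
    apply: integral_ge0 => u _; rewrite lee_fin !mulr_ge0//.
    by rewrite /acc le_max lexx.
  - move=> y _; apply: emeasurable_funM.
      apply/measurable_EFinP.
      exact: (measurableT_comp (f := fun n : nat => walk n y : R)).
    apply: measurable_fun_fubini_tonelli_F.
      apply/measurable_EFinP; rewrite /acc.
      have m1 : measurable_fun setT (fun zu : (nat * R) * R => abc_ratio a q zu.1.1 y).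
        apply: (measurableT_comp (f := fun n : nat => abc_ratio a q n y)) => //.
        exact: (measurableT_comp (f := fst)).
      have m2 : measurable_fun setT (fun zu : (nat * R) * R => (zu.1.2 `^ (-1))%R).
        apply: (measurableT_comp (f := fun r : R => (r `^ (-1))%R)) => //.
        exact: (measurableT_comp (f := snd)).
      have mB' : measurable_fun setT
          (fun zu : (nat * R) * R => \1_B (y, zu.2) : R).
        apply: (measurableT_comp (f := mindic R mB)) => //.
        by apply: measurable_fun_pair.
      have mI : measurable_fun setT (fun zu : (nat * R) * R =>
          \1_(`]0%R, +oo[%classic : set R) zu.2 : R).
        have mi : measurable (`]0%R, +oo[%classic : set R) by [].
        exact: (measurableT_comp (f := mindic R mi)).
      apply: measurable_funM => //; apply: measurable_funM => //.
      apply: measurable_maxr => //; apply: measurable_minr => //.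
      by apply: measurable_funM => //; apply: measurable_funM.
    by move=> zu; rewrite lee_fin !mulr_ge0// /acc le_max lexx.
have moveE B : measurable B -> measurable_fun
    (setT `&` (fun z : nat * R => (0 < z.1)%N && (0 < z.2)%R) @^-1` [set true])
    (fun z : nat * R => pm_move a q N z B).
  move=> mB; move: (mmove B mB) => /measurable_funTS h.
  apply: eq_measurable_fun (h _) => z; rewrite inE => -[_ /= /andP[_ z0]].
  rewrite /pm_move [RHS]eseries_cond; apply: eq_eseriesr => y _.
  congr (_ * _); rewrite /fubini_F [RHS]integral_mkcond.
  apply: eq_integral => u _; 
  rewrite patchE /f/= [X in (_ * X)%:E = _]indicE.
  case: ifPn => [|_]; last by rewrite mulr0.
  rewrite inE/= in_itv/= andbT => u0; rewrite mulr1 /acc/= powR_inv1 ?ltW//.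
  by rewrite max_r// (@pm_accept_ge0 z).
rewrite /pm_kernel /pm_trans; apply: measurable_fun_if => //.
- apply: emeasurable_funD; first exact: moveE.
  apply: emeasurable_funM; last exact: measurable_funTS.
  by apply: emeasurable_funB => //; exact: moveE.
- exact: measurable_funTS.
Qed.

HB.instance Definition _ :=
  isKernel.Build _ _ _ _ R pm_kernel measurable_pm_kernel.

Let pm_kernel_setT z : pm_kernel z setT = 1.
Proof.
rewrite /pm_kernel/= /pm_trans diracT mule1; case: ifPn => // /andP[_ z0].
by rewrite addeC subeK// pm_move_fin_num.
Qed.

HB.instance Definition _ :=
  Kernel_isProbability.Build _ _ _ _ R pm_kernel pm_kernel_setT.


Lemma pm_kernel_offdiag (z : nat * R) (A : set (nat * R)) :
  (0 < z.1)%N -> (0 < z.2)%R -> ~ A z ->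
  pm_kernel z A =
  \sum_(1 <= y <oo) (walk z.1 y)%:E *
    \int[abc_weight_law a N y]_(u in `]0%R, +oo[)
      (Num.min 1 (abc_ratio a q z.1 y * (u / z.2)) * \1_A (y, u))%:E.
Proof.
move=> z1 z2 zA; rewrite /pm_kernel/= /pm_trans z1 z2/= diracE memNset//.
by rewrite mule0 adde0.
Qed.

Local Close Scope ereal_scope.

End proofs.

End abc_model.

(* Main.v *)
(* Test the inequality on the centred indicator of the layer [x = m + 2], whose
   mass is [p = (1 - aq) (aq)^(m+1)]. A move into a layer [y >= m + 1] is only
   accepted if some pseudo-observation at [y] succeeds, which has probability at
   most [N a^m], so the chain leaves and enters the test layer at rate at most
   [N a^m]. Hence [p (1 - p - 2 s N a^m) <= beta s]. Choosing [m] with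
   [a^m] of order [1 / s] gives [beta s >= p / 4], where [p] is of order
   [(aq)^m = (a^m)^(log (aq) / log a)]. *)

Require Import Defs.
From HB Require Import structures.
From mathcomp Require Import all_boot all_order all_algebra.
From mathcomp Require Import all_classical all_reals all_analysis.
From mathcomp Require Import measurable_realfun ess_sup_inf.
From mathcomp Require Import ring lra.
Import Order.TTheory GRing.Theory Num.Theory.
Import numFieldNormedType.Exports.
Local Open Scope classical_set_scope.
Local Open Scope ring_scope.

(** * Weak Poincaré inequality tested on a centred indicator *)

(** Since an indicator equals its square, the mean, the variance and the Dirichlet majorant of a
    centred indicator, as well as its image under a kernel, are all integrals of this affine
    form. *)
Lemma integral_affine_indic {d} {T : measurableType d} {R : realType}
    {mu : {measure set T -> \bar R}} {A : set T} (c k : R) :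
  mu setT = 1%E -> measurable A ->
  (\int[mu]_z (c * \1_A z + k)%:E = (c * fine (mu A) + k)%:E)%E.
Proof.
move=> mu1 mA.
have muoo : (mu setT < +oo)%E by rewrite mu1 ltry.
have muA : mu A \is a fin_num.
  rewrite ge0_fin_numE// (le_lt_trans _ muoo)//.
  by apply: le_measure => //; rewrite inE.
have iA : mu.-integrable setT (EFin \o (\1_A : T -> R)).
  apply: measurable_bounded_integrable => //.
  exists 1; split; [exact: num_real|move=> y /ltW y1 x _].
  by rewrite /= indicE (le_trans _ y1)// ger0_norm// lern1 leq_b1.
have ik : mu.-integrable setT (EFin \o cst k).
  apply: measurable_bounded_integrable => //.
  by exists `|k|; split; [exact: num_real|move=> y /ltW ky x _].
under eq_integral do rewrite EFinD EFinM.
rewrite integralD//=; last exact: integrableZl.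
rewrite integralZl// integral_indic// setIT.
by rewrite (integral_cst mu measurableT k%:E) mu1 mule1 EFinD EFinM fineK.
Qed.

Lemma centred_indic_Lfun2 {d} {T : measurableType d} {R : realType}
    {mu : {measure set T -> \bar R}} {A : set T} {p : R} :
  mu setT = 1%E -> measurable A -> 0 <= p <= 1 ->
  (fun z => \1_A z - p) \in Lfun mu 2%:E.
Proof.
move=> mu1 mA p01.
have mf : measurable_fun setT (fun z => \1_A z - p : R).
  by apply: measurable_funB => //.
rewrite inE; apply/andP; split; rewrite inE//=.
rewrite /finite_norm unlock poweR_lty//.
rewrite (eq_integral (fun z => (`|\1_A z - p| `^ 2)%:E))//.
apply: (@le_lt_trans _ _ (\int[mu]_z (cst 1 z))%E); last first.
  by rewrite integral_cst// mu1 mule1 ltry.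
apply: ge0_le_integral => //.
- apply/measurable_EFinP.
  apply: (measurableT_comp (measurable_powR _)).
  exact: measurableT_comp.
- move=> z _ /=; rewrite lee_fin powR_mulrn// exprn_ile1//.
  rewrite indicE; case: (_ \in _) => /=; rewrite ler_norml; lra.
Qed.

(** The values of the function lie between [-p] and [1 - p]. A bound on the square also needs the
    oscillation to be nonnegative; this holds because [mu] has positive mass. *)
Lemma osc_norm_sqr_le1 {d} {T : measurableType d} {R : realType}
    {mu : {measure set T -> \bar R}} {A : set T} {p : R} :
  mu setT = 1%E ->
  (osc_norm mu (fun z => \1_A z - p)%R ^+ 2 <= 1)%E.
Proof.
move=> mu1; set f := fun z => _.
have mu0 : (0 < mu setT)%E by rewrite mu1.
have lo z : ((- p)%:E <= (f z)%:E)%E.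
  by rewrite lee_fin /f lerBrDr addNr.
have hi z : ((f z)%:E <= (1 - p)%:E)%E.
  by rewrite lee_fin /f lerB// indicE lern1 leq_b1.
have sup_le : (ess_sup mu (EFin \o f) <= (1 - p)%:E)%E by exact: ess_sup_ler.
have inf_ge : ((- p)%:E <= ess_inf mu (EFin \o f))%E by exact: ess_inf_ler.
have inf_sup : (ess_inf mu (EFin \o f) <= ess_sup mu (EFin \o f))%E.
  by apply: ess_sup_gee => //; exact: ess_inf_le.
have osc_le : (osc_norm mu f <= 1)%E.
  rewrite /osc_norm; apply: (le_trans (leeB sup_le inf_ge)).
  by rewrite -EFinB lee_fin; lra.
have osc_ge : (0 <= osc_norm mu f)%E.
  rewrite /osc_norm sube_ge0// fin_numElt; apply/orP; left.
  rewrite (lt_le_trans (ltNyr _) inf_ge)/=.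
  by rewrite (le_lt_trans (le_trans inf_sup sup_le))// ltry.
by rewrite expe2 -[leRHS]mule1 lee_pmul.
Qed.

(* The test function is the centred indicator of [A]; its Dirichlet form is
   bounded pointwise, so that [mu] need not be invariant under [P]. *)
Lemma WPI_bottleneck {d} {T : measurableType d} {R : realType}
    {mu : {measure set T -> \bar R}} {P : R.-pker T ~> T} {beta : R -> R}
    {A : set T} {p eps s : R} :
  is_WPI mu P (fun f => (osc_norm mu f ^+ 2)%E) beta ->
  mu setT = 1%E -> measurable A -> mu A = p%:E ->
  (forall z, A z -> (P z (~` A) <= eps%:E)%E) ->
  (forall z, ~ A z -> (P z A <= eps%:E)%E) ->
  0 < s -> p * (1 - p - 2 * s * eps) <= beta s.
Proof.
move=> [beta0 _ _ wpi] mu1 mA muA PAc PA s0.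
have p01 : 0 <= p <= 1.
  rewrite -!lee_fin -muA measure_ge0/= -mu1.
  by apply: le_measure => //; rewrite inE.
pose f z : R := \1_A z - p.
have P1 z : P z setT = 1%E by exact: prob_kernel.
have PzA z : P z A \is a fin_num.
  rewrite ge0_fin_numE// (@le_lt_trans _ _ 1%E) ?ltry// -(P1 z).
  by apply: le_measure => //; rewrite inE.
have Pf z : markov_op P f z = fine (P z A) - p.
  rewrite /markov_op /Rintegral /f.
  under eq_integral do rewrite -[X in (X - _)%R]mul1r.
  by rewrite (integral_affine_indic _ _ (P1 z) mA)/= mul1r.
have f0 : (\int[mu]_z (f z)%:E = 0)%E.
  rewrite /f; under eq_integral do rewrite -[X in (X - _)%R]mul1r.
  by rewrite (integral_affine_indic _ _ mu1 mA)/= muA/= mul1r subrr.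
have ff : inner_prod mu f f = (p * (1 - p))%:E.
  rewrite /inner_prod; transitivity
      (\int[mu]_z ((1 - 2 * p) * \1_A z + p ^+ 2)%:E)%E.
    apply: eq_integral => z _; congr EFin.
    by rewrite /f indicE; case: (_ \in _) => /=; ring.
  by rewrite (integral_affine_indic _ _ mu1 mA) muA/=; congr EFin; ring.
(* [eps] dominates some kernel mass at every point, and a point exists because [mu] has mass one. *)
have eps0 : 0 <= eps.
  rewrite -lee_fin; have [z|T0] := pselect (exists z : T, True).
    have [z0 _] := z; have [Az|Az] := pselect (A z0).
      exact: le_trans (PAc _ Az).
    exact: le_trans (PA _ Az).
  have : mu setT = 0%E; last by rewrite mu1 => -[] /eqP; rewrite oner_eq0.
  rewrite (_ : setT = set0) ?measure0//; apply/seteqP; split => // z _.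
  by apply: T0; exists z.
have dirichlet : (inner_prod mu (f \- markov_op P f)%R f <=
    (2 * p * eps)%:E)%E.
  (* The majorant is [eps * (1 + p)] on [A], where [eps * (1 - p)] would suffice, and [eps * p] off
     [A]. *)
  have -> : (2 * p * eps)%:E = (\int[mu]_z (eps * \1_A z + p * eps)%:E)%E.
    by rewrite (integral_affine_indic _ _ mu1 mA) muA/=; congr EFin; ring.
  (* On [A], [f - P f] is the escape probability and [f = 1 - p]; off [A], [f - P f] is minus the
     entrance probability and [f = - p]. *)
  have fE z : (f z - markov_op P f z) * f z =
      if z \in A then fine (P z (~` A)) * (1 - p) else fine (P z A) * p.
    have -> : fine (P z (~` A)) = 1 - fine (P z A).
      rewrite -setTD measureD//; last by rewrite [X in (X < _)%E](P1 z) ltry.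
      by rewrite setTI [X in (X - _)%E](P1 z) fineB//; exact: PzA.
    rewrite Pf /f; move: (fine (P z A)) => x.
    by rewrite indicE; case: (_ \in _) => /=; ring.
  apply: ge0_le_integral => //.
  - move=> z _; rewrite lee_fin fE.
    by case: ifP => _; rewrite mulr_ge0 ?fine_ge0//; lra.
  - apply/measurable_EFinP; apply: measurable_funM; last first.
      by apply: measurable_funB.
    rewrite (_ : _ \- _ = (fun z => \1_A z - fine (P z A))); last first.
      by apply/funext => z; rewrite /= Pf /f; ring.
    apply: measurable_funB => //.
    by apply: measurableT_comp => //; exact: measurable_kernel.
  - apply/measurable_EFinP; apply: measurable_funD => //.
    exact: measurable_funM.
  - move=> z _; rewrite lee_fin fE indicE; case: ifPn => zA /=.
      have : fine (P z (~` A)) <= eps.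
        rewrite -lee_fin fineK; first by apply: PAc; rewrite inE in zA.
        rewrite ge0_fin_numE// (@le_lt_trans _ _ eps%:E) ?ltry//.
        by apply: PAc; rewrite inE in zA.
      have : 0 <= fine (P z (~` A)) by exact: fine_ge0.
      by nra.
    have : fine (P z A) <= eps.
      by rewrite -lee_fin fineK//; apply: PA; rewrite notin_setE in zA.
    by nra.
have := wpi s f s0 (centred_indic_Lfun2 mu1 mA p01) f0.
rewrite ff => h.
have {}h : ((p * (1 - p))%:E <= s%:E * (2 * p * eps)%:E + (beta s)%:E * 1)%E.
  apply: (le_trans h); apply: leeD.
    by apply: lee_wpmul2l => //; rewrite lee_fin ltW.
  apply: lee_wpmul2l; first by rewrite lee_fin beta0.
  exact: osc_norm_sqr_le1.
by move: h; rewrite mule1 -EFinM -EFinD lee_fin; lra.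
Qed.

(** * Weight law, posterior and target of the ABC chain *)

Section pm_estimates.
Context {R : realType} (a q : {itv R & `]0, 1[}) (N : nat).

(** Absorbing [b i] into the [i]-th factor makes the sum over [b] a product of one-coordinate sums:
    the [i]-th equals [p], the others equal 1. *)
Lemma bernoulli_prod_mean (p : R) (i : 'I_N) :
  \sum_(b : {ffun 'I_N -> bool})
    (\prod_(j < N) bernoulli_pmf p (b j)) * (b i)%:R = p.
Proof.
transitivity (\sum_(b : {ffun 'I_N -> bool})
    \prod_(j < N) (bernoulli_pmf p (b j) * (if j == i then (b i)%:R else 1))).
  apply: eq_bigr => b _; rewrite big_split/=; congr (_ * _).
  by rewrite -big_mkcond/= big_pred1_eq.
rewrite (eq_bigr (fun b : {ffun 'I_N -> bool} => \prod_(j < N)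
    (bernoulli_pmf p (b j) * (if j == i then (b j)%:R else 1)))); last first.
  by move=> b _; apply: eq_bigr => j _; case: eqP => // ->.
rewrite -(bigA_distr_bigA (fun j (c : bool) =>
  bernoulli_pmf p c * (if j == i then c%:R else 1)))/=.
rewrite (bigD1 i)//= big_bool/= eqxx mulr1 mulr0 addr0 big1 ?mulr1// => j ji.
by rewrite big_bool/= (negbTE ji) !mulr1 addrC subrK.
Qed.

Lemma abc_lik_gt0 {x} : (0 < x)%N -> 0 < abc_lik a x.
Proof. by move=> x0; rewrite /abc_lik x0 mul1r exprn_gt0. Qed.

(** The law is a finite mixture of Dirac masses, so integration is a finite weighted sum. *)
Lemma integral_abc_weight_law x (D : set R) (f : R -> R) :
  measurable D -> measurable_fun D f -> (forall w, D w -> 0 <= f w) ->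
  (\int[abc_weight_law a N x]_(w in D) (f w)%:E =
   (\sum_(b : {ffun 'I_N -> bool})
     (\prod_(i < N) bernoulli_pmf (abc_lik a x) (b i)) *
     (\1_D (abc_weight a x b) * f (abc_weight a x b)))%:E)%E.
Proof.
move=> mD mf f0; pose r := index_enum {ffun 'I_N -> bool}.
have pmf_ge0 (b : {ffun 'I_N -> bool}) :
    0 <= \prod_(i < N) bernoulli_pmf (abc_lik a x) (b i).
  by apply: prodr_ge0 => i _; exact/bernoulli_pmf_ge0/abc_lik_itv.
(* The default [[ffun=> true]] is never reached, as only indices below [size r] are summed. *)
pose b_ n : {ffun 'I_N -> bool} := nth [ffun=> true] r n.
pose m_ n : {measure set R -> \bar R} :=
  mscale (NngNum (pmf_ge0 (b_ n))) \d_(abc_weight a x (b_ n)).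
rewrite (eq_measure_integral (msum m_ (size r))); last first.
  move=> B mB _; rewrite /= /abc_weight_law /msum.
  by rewrite (big_nth [ffun=> true]) big_mkord.
have mEf : measurable_fun D (EFin \o f) by exact/measurable_EFinP.
rewrite ge0_integral_measure_sum//.
rewrite -sumEFin (big_nth [ffun=> true]) big_mkord.
apply: eq_bigr => n _; rewrite ge0_integral_mscale//= integral_dirac//.
Qed.

Lemma abc_prior_likE x : (0 < x)%N -> abc_prior q x * abc_lik a x =
  (1 - q%:num) * (a%:num * q%:num) ^+ x.-1.
Proof.
by move=> x0; rewrite /abc_prior /abc_lik x0 !mul1r exprMn; ring.
Qed.

Lemma aq_lt1 : a%:num * q%:num < 1 :> R.
Proof. by rewrite mulr_ilt1. Qed.

(** Dropping the zero term leaves a geometric series. It gives the normalising constant of the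
    posterior with [c = 1 - q], and its total mass with [c = 1 - aq]. *)
Lemma cvg_geometric_pred (c : R) (u : R^nat) : u 0%N = 0 ->
  (forall x, (0 < x)%N -> u x = c * (a%:num * q%:num) ^+ x.-1) ->
  series u @ \oo --> c / (1 - a%:num * q%:num).
Proof.
move=> u0 uE; rewrite -cvg_shiftS.
rewrite (_ : (fun n => series u n.+1) =
    series (geometric c (a%:num * q%:num))); last first.
  apply/funext => n; rewrite /series/= big_nat_recl// u0 add0r.
  by apply: eq_bigr => i _; rewrite uE.
by apply: cvg_geometric_series; rewrite ger0_norm// aq_lt1.
Qed.


(** Unbiasedness of the likelihood estimator: each [b i / l] has mean one. *)
Lemma abc_weight_mean x : (0 < N)%N -> (0 < x)%N ->
  (\int[abc_weight_law a N x]_(w in `]0%R, +oo[) w%:E = 1)%E.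
Proof.
move=> N0 x0; rewrite integral_abc_weight_law//; last first.
  by move=> w /=; rewrite in_itv/= andbT => /ltW.
congr EFin; pose l := abc_lik a x; have l0 : 0 < l := abc_lik_gt0 x0.
transitivity (\sum_(b : {ffun 'I_N -> bool}) \sum_(i < N) (N%:R^-1 / l) *
    ((\prod_(j < N) bernoulli_pmf l (b j)) * (b i)%:R)).
  apply: eq_bigr => b _; rewrite -mulr_sumr -mulr_sumr.
  set pr := \prod_(j < N) _.
  have -> : \1_(`]0%R, +oo[%classic : set R) (abc_weight a x b) *
      abc_weight a x b = abc_weight a x b.
    rewrite indicE; have [|] := boolP (_ \in _); rewrite ?mul1r//.
    rewrite notin_setE/= in_itv/= andbT => /negP; rewrite -leNgt => w_le0.
    suff : 0 <= abc_weight a x b by move=> w_ge0; rewrite mul0r; lra.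
    by rewrite mulr_ge0// sumr_ge0// => i _; rewrite divr_ge0// ltW.
  by rewrite /abc_weight -mulr_suml; ring.
rewrite exchange_big/=; under eq_bigr do rewrite -mulr_sumr bernoulli_prod_mean.
rewrite sumr_const card_ord -[LHS]mulr_natl divfK ?gt_eqF// divff//.
by rewrite pnatr_eq0 -lt0n.
Qed.

(** Union bound: a positive weight requires a success, so its indicator is at most the number of
    successes, of mean [N * abc_lik a x]. *)
Lemma abc_weight_gt0_le {x} : (0 < x)%N ->
  (abc_weight_law a N x `]0%R, +oo[ <= (N%:R * abc_lik a x)%:E)%E.
Proof.
move=> x0; rewrite /abc_weight_law.
rewrite (eq_bigr (fun b : {ffun 'I_N -> bool} =>
  ((\prod_(i < N) bernoulli_pmf (abc_lik a x) (b i)) *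
   \1_(`]0%R, +oo[%classic : set R) (abc_weight a x b))%:E)); last first.
  by move=> b _; rewrite diracE indicE EFinM.
rewrite sumEFin lee_fin.
apply: (@le_trans _ _ (\sum_(b : {ffun 'I_N -> bool}) \sum_(i < N)
    ((\prod_(j < N) bernoulli_pmf (abc_lik a x) (b j)) * (b i)%:R))).
  apply: ler_sum => b _; rewrite -mulr_sumr ler_wpM2l//.
    by apply: prodr_ge0 => i _; exact/bernoulli_pmf_ge0/abc_lik_itv.
  rewrite -natr_sum indicE ler_nat.
  case: (boolP (_ \in _)) => //; rewrite inE/= in_itv/= andbT => w0.
  rewrite lt0n sum_nat_eq0; apply: contraL w0 => /forallP b0.
  rewrite -leNgt /abc_weight big1 ?mulr0// => i _.
  by have /eqP -> := b0 i; rewrite mul0r.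
rewrite exchange_big/=; under eq_bigr do rewrite bernoulli_prod_mean.
by rewrite sumr_const card_ord mulr_natl.
Qed.

Lemma abc_postE x : (0 < x)%N ->
  abc_post a q x = (1 - a%:num * q%:num) * (a%:num * q%:num) ^+ x.-1.
Proof.
move=> x0; rewrite /abc_post.
have := @cvg_geometric_pred (1 - q%:num)
  (fun k => abc_prior q k * abc_lik a k).
rewrite {1}/abc_lik ltnn mul0r mulr0 => /(_ erefl abc_prior_likE).
move=> /cvg_lim -> //; rewrite abc_prior_likE//.
by rewrite invf_div mulrC mulrA divfK// subr_eq0 gt_eqF.
Qed.

Lemma sum_abc_post : (\sum_(1 <= x <oo) (abc_post a q x)%:E = 1)%E.
Proof.
rewrite [LHS]eseries_cond eseries_mkcond.
pose u x : R := if (0 < x)%N then abc_post a q x else 0.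
rewrite (eq_eseriesr (g := EFin \o u)); last by move=> x _; rewrite /u/=; case: ifP.
have := @cvg_geometric_pred (1 - a%:num * q%:num) u erefl.
rewrite divff ?subr_eq0 ?gt_eqF ?aq_lt1// => cu.
apply/cvg_lim => //; under eq_fun do rewrite sumEFin.
apply: cvg_EFin; first exact: nearW.
by apply: cu => x x0; rewrite /u x0 abc_postE.
Qed.

(** The weights have mean one on each layer, so the [x]-marginal of the target is the posterior. *)
Lemma pm_target_layers (B : nat -> bool) : (0 < N)%N ->
  (pm_target a q N [set z | B z.1] =
   \sum_(1 <= x <oo) (abc_post a q x * (B x)%:R)%:E)%E.
Proof.
move=> N0; rewrite /pm_target [LHS]eseries_cond [RHS]eseries_cond.
apply: eq_eseriesr => x x0; rewrite [RHS]EFinM; congr (_ * _)%E.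
have -> : \1_[set z : nat * R | B z.1] = (fun z => (B z.1)%:R) :> (_ -> R).
  by apply/funext => z; rewrite indicE; case: (boolP (B z.1)) => Bz;
    [rewrite mem_set|rewrite memNset//; exact/negP].
case: (B x) => /=.
  by under eq_integral do rewrite mulr1; rewrite abc_weight_mean.
by under eq_integral do rewrite mulr0; rewrite integral0.
Qed.

Lemma pm_target_setT : (0 < N)%N -> pm_target a q N setT = 1%E.
Proof.
move=> N0; have -> : setT = [set z : nat * R | true] by apply/seteqP.
rewrite (pm_target_layers (fun=> true))//.
by under eq_eseriesr do rewrite mulr1; exact: sum_abc_post.
Qed.

Lemma pm_target_layer n : (0 < N)%N -> (0 < n)%N ->
  pm_target a q N [set z | z.1 == n] = (abc_post a q n)%:E.
Proof.
move=> N0 n0; rewrite (pm_target_layers (fun x => x == n))//.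
rewrite eseries_cond (nneseriesD1 (n := n))//=; last first.
  by move=> x _; rewrite lee_fin mulr_ge0 ?abc_post_ge0.
rewrite eqxx mulr1 eseries0 ?adde0// => x _ /andP[_ /negbTE->].
by rewrite mulr0.
Qed.

(** * Bounds on the rate of moves *)

(** Acceptance is at most 1 but requires a positive weight at [y], of probability at most
    [N * a ^ (y - 1)]; the walk probabilities sum to at most 1. *)
Lemma pm_move_le m z (A : set (nat * R)) :
  measurable A -> 0 < z.2 ->
  (forall y u, walk z.1 y != 0 :> R -> A (y, u) -> (m < y)%N) ->
  (pm_move a q N z A <= (N%:R * a%:num ^+ m)%:E)%E.
Proof.
move=> mA z0 mA_lt.
have term_ge0 y : (0 <= \int[abc_weight_law a N y]_(u in `]0%R, +oo[)
      (pm_accept a q z (y, u) * \1_A (y, u))%:E)%E.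
  apply: (@layered_int_ge0 _ (fun y u => pm_accept a q z (y, u))) => y' u.
  exact: pm_accept_ge0.
apply: (@le_trans _ _
    (\sum_(1 <= y <oo) (walk z.1 y * (N%:R * a%:num ^+ m))%:E)%E).
  rewrite [leLHS]eseries_cond [leRHS]eseries_cond.
  apply: lee_nneseries => [y _ _|y /= y0].
    by rewrite mule_ge0// lee_fin walk_ge0.
  have [->|wy] := eqVneq (walk z.1 y : R) 0; first by rewrite mul0e mul0r.
  rewrite EFinM lee_wpmul2l ?lee_fin ?walk_ge0//.
  have [my|ym] := ltnP m y; last first.
    rewrite integral0_eq ?lee_fin ?mulr_ge0 ?exprn_ge0// => u _.
    rewrite indicE memNset ?mulr0// => Ayu.
    by have := mA_lt _ _ wy Ayu; rewrite ltnNge ym.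
  (* From [m < y] follows [m <= y - 1], the exponent in the likelihood. *)
  apply: (@le_trans _ _ (abc_weight_law a N y `]0%R, +oo[)); last first.
    apply: (le_trans (abc_weight_gt0_le y0)).
    rewrite lee_fin ler_wpM2l// /abc_lik y0 mul1r ler_wiXn2l//.
    by case: y my {y0 wy}.
  rewrite -[leRHS]mul1e -integral_cst//; apply: ge0_le_integral => //.
  - move=> u /=; rewrite in_itv/= andbT => u0.
    by rewrite lee_fin mulr_ge0// pm_accept_ge0.
  - apply: measurable_funTS.
    apply: (@measurable_layer _ (fun y u => pm_accept a q z (y, u))) => //.
    by move=> y'; exact: measurable_pm_accept.
  - move=> u /=; rewrite in_itv/= andbT => u0.
    rewrite lee_fin mulr_ile1 ?pm_accept_ge0// ?indicE ?lern1 ?leq_b1//.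
    by rewrite /pm_accept ge_min lexx.
apply: lime_le.
  apply: is_cvg_nneseries => y _ _.
  by rewrite lee_fin !mulr_ge0 ?walk_ge0 ?exprn_ge0.
apply: nearW => n; rewrite sumEFin lee_fin -mulr_suml.
by rewrite ler_piMl ?mulr_ge0 ?exprn_ge0// sum_walk.
Qed.

(** As [z] is outside [A], the mass kept at [z] does not count, and an absorbing [z] gives [A] no
    mass. *)
Lemma pm_kernel_le {m z} {A : set (nat * R)} :
  measurable A -> ~ A z ->
  (forall y u, walk z.1 y != 0 :> R -> A (y, u) -> (m < y)%N) ->
  (pm_kernel a q N z A <= (N%:R * a%:num ^+ m)%:E)%E.
Proof.
move=> mA zA mA_lt; rewrite /pm_kernel/= /pm_trans diracE memNset// mule0 adde0.
case: ifP => [/andP[_ z0]|_]; first exact: pm_move_le.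
by rewrite lee_fin mulr_ge0 ?exprn_ge0.
Qed.

(* The bottleneck is the layer [x = m + 2], left or entered at rate at most
   [N * a ^ m]. *)
Lemma abc_WPI_lower_bound {beta m s} : (0 < N)%N ->
  is_WPI (pm_target a q N) (pm_kernel a q N)
    (fun f => (osc_norm (pm_target a q N) f ^+ 2)%E) beta ->
  0 < s -> abc_post a q m.+2 *
    (1 - abc_post a q m.+2 - 2 * s * (N%:R * a%:num ^+ m)) <= beta s.
Proof.
move=> N0 wpi s0.
have mA : measurable [set z : nat * R | z.1 == m.+2].
  rewrite (_ : [set _ | _] = fst @^-1` [set m.+2]); last first.
    by apply/seteqP; split => z /= /eqP.
  by rewrite -[X in measurable X]setTI; exact: measurable_fst.
apply: (WPI_bottleneck wpi _ mA) => //.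
- exact: pm_target_setT.
- exact: pm_target_layer.
(* The exits are [m + 1] and [m + 3]; the lower one dictates the exponent [m]. *)
- move=> z /= /eqP z1; apply: pm_kernel_le.
  + exact: measurableC.
  + by rewrite /= z1 eqxx.
  + move=> y u; rewrite z1 /walk; case: ifPn; last by rewrite eqxx.
    by move=> /orP[/eqP->|/eqP[<-]] _ _ //; rewrite !ltnS; exact: leqW.
- move=> z zA; apply: pm_kernel_le => // y u _ /= /eqP ->.
  exact: leqW.
Qed.

End pm_estimates.

(** * Asymptotics in [s] *)

Lemma is_Omega_lower_bound {R : realType} {f g : R -> R} {c : R} : 0 < c ->
  (\forall s \near +oo, c <= `|f s / g s|) -> is_Omega f g.
Proof.
move=> c0 cfg; apply: (@lt_le_trans _ _ c%:E); first by rewrite lte_fin.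
rewrite /limf_einf leeNr; apply: ge_ereal_inf => /=.
eexists; first by exists [set s | c <= `|f s / g s|].
by apply: ge_ereal_sup => _ [s /= cs <-] /=; rewrite lee_fin lerN2.
Qed.

(** Take the least [m] with [x ^ m <= t]. It is positive since [t < 1], and minimality gives
    [t < x ^ (m - 1)]. *)
Lemma exists_expr_itv {R : realType} {x t : R} : 0 < x < 1 -> 0 < t < 1 ->
  exists m, x * t <= x ^+ m <= t.
Proof.
move=> /andP[x0 x1] /andP[t0 t1].
have ex : exists m, x ^+ m <= t.
  have /cvgrPdist_le /(_ t t0)[m _ xm] : (GRing.exp x : R^nat) @ \oo --> 0.
    by apply: cvg_expr; rewrite ger0_norm// ltW.
  exists m; have := xm m (leqnn m).
  by rewrite /= sub0r normrN ger0_norm// exprn_ge0// ltW.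
have [m xm xmin] := ex_minnP ex; exists m; rewrite xm andbT.
case: m xm xmin => [|m] xm xmin; first by rewrite expr0 leNgt t1 in xm.
rewrite exprS ler_pM2l// leNgt; apply/negP => /ltW /xmin.
by rewrite ltnn.
Qed.

(** Source of the exponent: with [x = a] and [y = aq], posterior decay becomes a power of the
    acceptance rate. *)
Lemma expr_powR_ln {R : realType} {x y : R} (m : nat) : 0 < x < 1 -> 0 < y ->
  y ^+ m = (x ^+ m) `^ (ln y / ln x).
Proof.
move=> /andP[x0 x1] y0.
have yE : y = x `^ (ln y / ln x).
  rewrite /powR gt_eqF// divfK ?lnK//.
  by rewrite lt_eqF// ln_lt0// x0.
by rewrite -(powR_mulrn m (ltW x0)) powRAC -yE powR_mulrn// ltW.
Qed.

Theorem proposition90 (R : realType) (a q : {itv R & `]0, 1[}) (N : nat)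
    (N1 : (1 <= N)%N) (beta : R -> R) :
  is_WPI (pm_target a q N) (pm_kernel a q N)
    (fun f => (osc_norm (pm_target a q N) f ^+ 2)%E) beta ->
  is_Omega beta
    (fun s => s `^ (- (ln (a%:num * q%:num) / ln a%:num))).
Proof.
move=> wpi; set k := ln _ / _; pose r : R := a%:num * q%:num.
have a01 : 0 < (a%:num : R) < 1 by apply/andP; split.
have r0 : 0 < r by rewrite mulr_gt0.
have r1 : r < 1 := aq_lt1 a q.
have k0 : 0 <= k.
  by rewrite /k -mulrNN -invrN divr_ge0// oppr_ge0 ltW// ln_lt0// r0.
have N0 : 0 < N%:R :> R by rewrite ltr0n.
(* [(1 - r) * r] comes from [p = (1 - r) * r * r ^ m], the 4 from [p / 4 <= beta s], and the power
   from [a * t <= a ^ m]. *)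
pose c := (1 - r) * r / 4 * (a%:num / (4 * N%:R)) `^ k.
have c0 : 0 < c.
  by rewrite /c !mulr_gt0// ?subr_gt0// powR_gt0// divr_gt0// mulr_gt0.
apply: (is_Omega_lower_bound c0); near=> s.
have s1 : 1 < s by near: s; exact: nbhs_pinfty_gt.
have s0 : 0 < s by exact: lt_trans s1.
(* With this [t], [a ^ m <= t] makes the flow term [2 * s * N * a ^ m] at most 1/2. *)
pose t := (4 * N%:R * s)^-1.
have Ns1 : 1 < 4 * N%:R * s.
  have N1' : 1 <= N%:R :> R by rewrite ler1n.
  by nra.
have t01 : 0 < t < 1.
  have Ns0 := lt_trans ltr01 Ns1.
  by rewrite invr_gt0 invf_lt1// Ns0.
have [m /andP[atm amt]] := exists_expr_itv a01 t01.
have := abc_WPI_lower_bound a q N (m := m) N1 wpi s0.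
rewrite /= abc_postE//= -/r.
set p := (1 - r) * _ => bound.
have rmE : r ^+ m = (a%:num ^+ m) `^ k by exact: expr_powR_ln.
have pE : p = (1 - r) * r * r ^+ m by rewrite /p exprS mulrA.
have rm0 : 0 <= r ^+ m by rewrite exprn_ge0// ltW.
have rm1 : r ^+ m <= 1 by rewrite exprn_ile1// ltW.
have rr0 : 0 < (1 - r) * r by rewrite mulr_gt0// subr_gt0.
have p0 : 0 <= p by rewrite pE mulr_ge0// ltW.
have p4 : p <= 4^-1.
  rewrite pE; apply: (@le_trans _ _ ((1 - r) * r)).
    by rewrite ler_piMr// ltW.
  by have := sqr_ge0 (r - 2^-1); nra.
have half : 2 * s * (N%:R * a%:num ^+ m) <= 2^-1.
  have : s * N%:R * a%:num ^+ m <= s * N%:R * t.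
    by rewrite ler_pM2l// mulr_gt0.
  have -> : s * N%:R * t = 4^-1 by rewrite /t; field; rewrite !gt_eqF.
  by lra.
(* The bracket is at least [1 - 1/4 - 1/2]. *)
have {}bound : p / 4 <= beta s by nra.
have sk0 : 0 < s `^ (- k) by exact: powR_gt0.
have beta_ge0 : 0 <= beta s by rewrite (le_trans _ bound)// divr_ge0.
rewrite ger0_norm; last by rewrite divr_ge0// ltW.
rewrite ler_pdivlMr//; apply: le_trans bound.
have -> : c * s `^ (- k) = (1 - r) * r * (a%:num * t) `^ k / 4.
  have -> : a%:num * t = a%:num / (4 * N%:R) * s^-1.
    by rewrite /t invfM mulrA.
  rewrite powRM ?invr_ge0 ?(ltW s0)//.
  by rewrite -(powR_inv1 (ltW s0)) -powRrM mulN1r /c; ring.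
rewrite pE ler_pM2r// ler_pM2l// rmE.
(* Monotonicity of the power, as [k >= 0], applied to [a * t <= a ^ m]. *)
apply: ge0_ler_powR => //; rewrite nnegrE ?exprn_ge0//.
by rewrite mulr_ge0//; case/andP: t01 => /ltW.
Unshelve. all: by end_near.
Qed.
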